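(* Let $G$ be a cograph on $n$ vertices with cotree $T_G$ and let $a \in \mathbb{R}$. Let $D=[d_1,d_2,\ldots,d_n]$ be the diagonal returned by $\mathrm{Diagonalize}(T_G,-a)$, and assume $D$ has $k_{+}$ positive values, $k_0$ zeros, and $k_{-}$ negative values. Then: (i) the number of eigenvalues of $G$ (counted with multiplicity) that are greater than $a$ is exactly $k_{+}$; (ii) the number of eigenvalues of $G$ (counted with multiplicity) that are less than $a$ is exactly $k_{-}$; (iii) the multiplicity of $a$ as an eigenvalue of $G$ is $k_0$.
   Context: All graphs are finite, simple and undirected; the eigenvalues of a graph are those of its adjacency matrix. Cographs are the smallest class of graphs containing $K_1$ and closed under disjoint union $\cup$ and join $\otimes$. The cotree $T_G$ of a cograph $G$ is the unique rooted tree whose leaves are the vertices of $G$, whose interior nodes each have at least two children and are labelled $\cup$ or $\otimes$ so that the labels alternate along every root-to-leaf path, and such that two distinct vertices are adjacent in $G$ if and only if their least common ancestor is labelled $\otimes$; the cotree of a one-vertex graph is a single leaf. For a leaf $v$, $T_G - v$ denotes the cotree of $G-v$. Two vertices are siblings if they are leaves with the same parent in the cotree. Algorithm $\mathrm{Diagonalize}(T_G,x)$, $x\in\mathbb{R}$, where $G$ has vertices $v_1,\dots,v_n$: initialize $d_i \leftarrow x$ for all $i$ and $T \leftarrow T_G$. While $T$ has at least two leaves: choose a pair of siblings $\{v_k,v_l\}$ of maximum depth in $T$, with parent $w$; put $\alpha = d_k$, $\beta = d_l$ and do the following. If $w=\otimes$: (1a) if $\alpha+\beta\neq 2$: $d_k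 \leftarrow \alpha+\beta-2$, $d_l \leftarrow \frac{\alpha\beta-1}{\alpha+\beta-2}$, $T\leftarrow T-v_k$; (1b) if $\alpha+\beta=2$ and $\beta=1$: $d_k\leftarrow 0$, $d_l\leftarrow 1$, $T\leftarrow T-v_k$; (1c) if $\alpha+\beta=2$ and $\beta\ne 1$: $d_k\leftarrow -(1-\beta)^2$, $d_l\leftarrow 1$, and both $v_k$ and $v_l$ are removed from $T$. If $w=\cup$: (2a) if $\alpha+\beta\neq 0$: $d_k\leftarrow \alpha+\beta$, $d_l\leftarrow\frac{\alpha\beta}{\alpha+\beta}$, $T\leftarrow T-v_k$; (2b) if $\alpha+\beta=0$ and $\beta=0$: $d_k\leftarrow 0$, $d_l\leftarrow 0$, $T\leftarrow T-v_k$; (2c) if $\alpha+\beta=0$ and $\beta\neq 0$: $d_k\leftarrow -\beta$, $d_l\leftarrow \beta$, and both $v_k$ and $v_l$ are removed from $T$. After removals $T$ is the cotree of the subgraph of $G$ induced by the remaining vertices. The algorithm returns $[d_1,\dots,d_n]$. *)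

(* Defs.v *)
From Stdlib Require List.
From HB Require Import structures.
From mathcomp Require Import all_boot all_order all_algebra.
From mathcomp Require Import reals polyrcf.

Set Implicit Arguments.
Unset Strict Implicit.
Unset Printing Implicit Defensive.

Import Order.TTheory GRing.Theory Num.Theory.
Local Open Scope ring_scope.

Record sgraph (V : finType) := SGraph {
  adj :> rel V;
  adj_sym : symmetric adj;
  adj_irr : irreflexive adj }.

(* Combine G and H on the disjoint vertex sets V and W; b tells whether each
   vertex of V is adjacent to each vertex of W. *)
Definition sum_rel (V W : finType) (b : bool) (G : rel V) (H : rel W) :
    rel (V + W)%type :=
  fun x y => match x, y with
  | inl u, inl v => G u v
  | inr u, inr v => H u v
  | _, _ => b
  end.

Lemma sum_rel_sym (V W : finType) b (G : sgraph V) (H : sgraph W) :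
  symmetric (sum_rel b G H).
Proof. by case=> x [] y //=; apply: adj_sym. Qed.

Lemma sum_rel_irr (V W : finType) b (G : sgraph V) (H : sgraph W) :
  irreflexive (sum_rel b G H).
Proof. by case=> x /=; apply: adj_irr. Qed.

Definition gunion (V W : finType) (G : sgraph V) (H : sgraph W) :=
  SGraph (sum_rel_sym false G H) (sum_rel_irr false G H).

Definition gjoin (V W : finType) (G : sgraph V) (H : sgraph W) :=
  SGraph (sum_rel_sym true G H) (sum_rel_irr true G H).

Definition K1 : sgraph unit :=
  @SGraph unit (fun _ _ => false) (fun _ _ => erefl) (fun _ => erefl).

(* Graphs are taken up to isomorphism, hence the last constructor. *)
Inductive cograph : forall V : finType, sgraph V -> Prop :=
| cograph_K1 : cograph K1
| cograph_union (V W : finType) (G : sgraph V) (H : sgraph W) :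
    cograph G -> cograph H -> cograph (gunion G H)
| cograph_join (V W : finType) (G : sgraph V) (H : sgraph W) :
    cograph G -> cograph H -> cograph (gjoin G H)
| cograph_iso (V W : finType) (G : sgraph V) (H : sgraph W) (f : V -> W) :
    bijective f -> (forall x y, H (f x) (f y) = G x y) ->
    cograph G -> cograph H.

Inductive label := Union | Join.

Definition is_join (l : label) : bool := if l is Join then true else false.

(* The children form an unordered collection: nothing below depends on the
   order of the list. *)
Inductive tree (V : Type) :=
| Leaf of V
| Node of label & seq (tree V).

Fixpoint leaves (V : Type) (t : tree V) : seq V :=
  match t with
  | Leaf v => [:: v]
  | Node _ cs => flatten [seq leaves c | c <- cs]
  end.

Definition root_not_labelled (V : Type) (l : label) (t : tree V) : bool :=
  if t is Node l' _ then is_join l' != is_join l else true.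

Fixpoint cotree_shape (V : Type) (t : tree V) : bool :=
  match t with
  | Leaf _ => true
  | Node l cs => [&& (1 < size cs)%N, all (root_not_labelled l) cs
                   & all (@cotree_shape V) cs]
  end.

(* The subtree rooted at the least common ancestor of u and v: descend into the
   child containing both of them if there is one; otherwise nth returns its
   default value t. *)
Fixpoint lca (V : eqType) (u v : V) (t : tree V) : tree V :=
  match t with
  | Leaf _ => t
  | Node _ cs =>
      nth t [seq lca u v c | c <- cs]
        (find (fun c => (u \in leaves c) && (v \in leaves c)) cs)
  end.

(* The adjacency relation described by t (meaningful on the leaves of t). *)
Definition tree_adj (V : eqType) (t : tree V) : rel V :=
  fun u v => (u != v) && (if lca u v t is Node Join _ then true else false).

(* t is a cotree of the graph induced by e on the vertex set S. *)
Definition is_cotree (V : finType) (S : {set V}) (e : rel V) (t : tree V) :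
    Prop :=
  [/\ cotree_shape t, uniq (leaves t), leaves t =i S
    & {in S &, forall u v, u != v -> e u v = tree_adj t u v}].

(* The algorithm may remove all the vertices; None is the empty cotree. *)
Definition is_cotree_opt (V : finType) (S : {set V}) (e : rel V)
    (ot : option (tree V)) : Prop :=
  if ot is Some t then is_cotree S e t else S = set0.

Inductive node_at (V : Type) : nat -> tree V -> tree V -> Prop :=
| node_at_root t : node_at 0 t t
| node_at_child d l cs c s :
    List.In c cs -> node_at d c s -> node_at d.+1 (Node l cs) s.

(* u and v are distinct leaves of t at depth d.+1, with a common parent of
   label w at depth d. *)
Definition siblings_at (V : Type) (t : tree V) (d : nat) (w : label) (u v : V) :
    Prop :=
  u <> v /\ exists cs : seq (tree V),
    [/\ node_at d t (Node w cs), List.In (Leaf u) cs & List.In (Leaf v) cs].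

Definition deepest_siblings (V : Type) (t : tree V) (w : label) (u v : V) :
    Prop :=
  exists2 d, siblings_at t d w u v
    & forall d' w' u' v', siblings_at t d' w' u' v' -> (d' <= d)%N.

(* The new values of d_k and d_l, computed from their old values alpha and
   beta, and whether l is removed together with k. *)
Definition process (R : fieldType) (w : label) (alpha beta : R) :
    R * R * bool :=
  match w with
  | Join =>
      if alpha + beta != 2 then
        (alpha + beta - 2, (alpha * beta - 1) / (alpha + beta - 2), false)
      else if beta == 1 then (0, 1, false)
      else (- (1 - beta) ^+ 2, 1, true)
  | Union =>
      if alpha + beta != 0 then
        (alpha + beta, (alpha * beta) / (alpha + beta), false)
      else if beta == 0 then (0, 0, false)
      else (- beta, beta, true)
  end.

Section Diagonalize.

Variables (R : fieldType) (V : finType).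
Implicit Types (t : tree V) (d D : {ffun V -> R}).

Definition update d (k l : V) (dk dl : R) : {ffun V -> R} :=
  [ffun i => if i == k then dk else if i == l then dl else d i].

(* diag_step t d ot d': one pass through the loop may turn (t, d) into
   (ot, d'). *)
Inductive diag_step t d (ot : option (tree V)) : {ffun V -> R} -> Prop :=
| DiagStep (w : label) (k l : V) (dk dl : R) (both : bool) :
    deepest_siblings t w k l ->
    process w (d k) (d l) = (dk, dl, both) ->
    is_cotree_opt ([set v in leaves t] :\: (if both then [set k; l] else [set k]))
      (tree_adj t) ot ->
    diag_step t d ot (update d k l dk dl).

Inductive diag_loop : option (tree V) -> {ffun V -> R} -> {ffun V -> R} -> Prop :=
| diag_halt_empty d : diag_loop None d d
| diag_halt t d : (size (leaves t) < 2)%N -> diag_loop (Some t) d d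
| diag_continue t d ot d' D :
    (2 <= size (leaves t))%N ->
    diag_step t d ot d' -> diag_loop ot d' D -> diag_loop (Some t) d D.

(* D is the output of some run on t, started from the constant vector x; runs
   differ by the choice of the sibling pairs. *)
Definition Diagonalize t (x : R) D : Prop := diag_loop (Some t) [ffun=> x] D.

End Diagonalize.

Definition adjmx (R : nzRingType) (n : nat) (G : sgraph 'I_n) : 'M[R]_n :=
  \matrix_(i, j) (G i j)%:R.

(* Multiplicity of a as a root of the characteristic polynomial. *)
Definition eigen_mult (R : fieldType) (n : nat) (A : 'M[R]_n) (a : R) : nat :=
  mup a (char_poly A).

(* The real eigenvalues of A, each repeated according to its multiplicity; for
   symmetric A, these are all the eigenvalues. *)
Definition eigenvalues (R : rcfType) (n : nat) (A : 'M[R]_n) : seq R :=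
  flatten [seq nseq (eigen_mult A x) x | x <- rootsR (char_poly A)].

(* Main.v *)
Require Import Defs.
From HB Require Import structures.
From mathcomp Require Import all_boot all_order all_algebra.
From mathcomp Require Import reals polyrcf complex ring.

Set Implicit Arguments.
Unset Strict Implicit.
Unset Printing Implicit Defensive.

Import Order.TTheory GRing.Theory Num.Theory.
Import sesquilinear.
Local Open Scope ring_scope.

(** The algorithm is symmetric Gaussian elimination in disguise.  Let
    A be the adjacency matrix.  When the cotree T has leaf set S and the
    current values are d, consider the symmetric matrix with diagonal d whose
    off-diagonal entries are those of A inside S x S and zero elsewhere
    ([partial_mx]).  At the start it is A - a I, and at the end, when at most one
    vertex is left, it is the diagonal matrix of D.

    Every pass through the loop replaces this matrix by a congruent one.
    Siblings k, l of a cotree are twins ([tree_adj_siblings]): every other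
    vertex is adjacent to both or to neither, and k is adjacent to l exactly
    when the parent is a join.  Hence subtracting row and column l from row and
    column k clears the whole row k, except for the entries (k, k) and (k, l)
    ([twin_difference]).  If the new pivot s = alpha + beta - 2 A(k, l) is nonzero,
    or if the entry (k, l) is zero too, then k can be split off
    ([twins_split]); these are the cases (a) and (b) of the algorithm.
    Otherwise the nonzero entry (k, l) clears the rest of row l, and a
    hyperbolic plane spanned by k and l is split off ([twins_hyperbolic]); this is
    case (c).

    So A - a I is congruent to the diagonal matrix of D
    ([diag_loop_congruent]).  The spectral theorem makes A - a I unitarily
    congruent, over the complex numbers, to the diagonal matrix of the
    lambda - a, for lambda the eigenvalues of A.  Sylvester's law of inertia
    for two real diagonal matrices ([inertia_le], by a dimension count) then says
    that D has as many positive (negative) entries as there are eigenvalues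
    above (below) a, and the zeros are counted by the complement. *)

(** * Siblings of a cotree are twins *)

(** When no child contains u, [find] returns the length of cs and [nth] its default
    value, the root t. *)
Lemma lca_miss (V : eqType) (u v : V) (t : tree V) (cs : seq (tree V)) :
  u \notin flatten [seq leaves c | c <- cs] ->
  nth t [seq lca u v c | c <- cs]
    (find (fun c => (u \in leaves c) && (v \in leaves c)) cs) = t.
Proof.
elim: cs => //= c cs IH; rewrite mem_cat negb_or => /andP[/negPf-> /=].
exact: IH.
Qed.

Lemma leaves_child (V : eqType) (u : V) c (cs : seq (tree V)) :
  List.In c cs -> u \in leaves c -> u \in flatten [seq leaves c | c <- cs].
Proof.
elim: cs => //= c0 cs IH [->|c_cs] u_c; rewrite mem_cat ?u_c //.
by rewrite IH ?orbT.
Qed.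

Lemma uniq_leaves_child (V : eqType) c (cs : seq (tree V)) :
  List.In c cs -> uniq (flatten [seq leaves c | c <- cs]) -> uniq (leaves c).
Proof.
elim: cs => //= c0 cs IH c_cs; rewrite cat_uniq => /and3P[Uc0 _ Ucs].
by case: c_cs => [<-//|c_cs]; apply: IH.
Qed.

(** Since no leaf is repeated, the child c containing u is the only one in which
    the search can succeed. *)
Lemma lca_child (V : eqType) (u v : V) (t c : tree V) (cs : seq (tree V)) :
  List.In c cs -> uniq (flatten [seq leaves c | c <- cs]) -> u \in leaves c ->
  nth t [seq lca u v c | c <- cs]
    (find (fun c => (u \in leaves c) && (v \in leaves c)) cs)
  = if v \in leaves c then lca u v c else t.
Proof.
move=> c_cs + u_c; elim: cs c_cs => //= c0 cs IH c_cs.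
rewrite cat_uniq => /and3P[_ /hasPn disj Ucs].
case: c_cs => [Dc|c_cs]; first subst c0.
  rewrite u_c /=; case: ifP => //= _; rewrite lca_miss //.
  by apply/negP => /disj /=; rewrite u_c.
have /disj/negPf-> := leaves_child c_cs u_c.
exact: IH.
Qed.

Lemma node_at_leaves (V : eqType) d (t s : tree V) :
  node_at d t s -> {subset leaves s <= leaves t}.
Proof.
by elim=> {d t s} [t v|d lab cs c s c_cs _ IH v /IH] //; apply: leaves_child.
Qed.

Lemma siblings_leaves (V : eqType) d (t : tree V) w k l :
  siblings_at t d w k l -> k \in leaves t /\ l \in leaves t.
Proof.
move=> [_ [cs [t_cs k_cs l_cs]]].
by split; apply: (node_at_leaves t_cs); [apply: leaves_child k_cs _ |
  apply: leaves_child l_cs _]; rewrite inE.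
Qed.

(** Down to the parent of k and l, both lie in the same child at every node, so a
    search for k and i and a search for l and i take the same path; at the parent,
    k and l are themselves children and both searches stop. *)
Lemma lca_siblings (V : eqType) d (t : tree V) w k l :
  uniq (leaves t) -> siblings_at t d w k l ->
  is_join w = (if lca k l t is Node Join _ then true else false) /\
  {in [predC [:: k; l]], lca k ^~ t =1 lca l ^~ t}.
Proof.
move=> + [/eqP neq_kl [cs [t_cs k_cs l_cs]]].
move Ds: (Node w cs) t_cs => s t_s.
elim: t_s Ds => {d t s} [t|d lab ds c s c_ds c_s IH] Ds.
  rewrite -{}Ds /= => Ucs; split=> [|i].
    rewrite (lca_child _ _ k_cs) ?inE // eq_sym (negPf neq_kl).
    by case: w.
  rewrite !inE negb_or => /andP[/negPf ik /negPf il].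
  by rewrite (lca_child _ _ k_cs) ?(lca_child _ _ l_cs) ?inE ?ik ?il.
move=> /= Uds; have Uc := uniq_leaves_child c_ds Uds.
have [k_c l_c] : k \in leaves c /\ l \in leaves c.
  apply: (@siblings_leaves _ d _ w); split; first exact/eqP.
  by exists cs; rewrite Ds; split.
have [join_w eq_kl] := IH Ds Uc.
split=> [|i i_kl]; first by rewrite (lca_child _ _ c_ds) ?l_c.
by rewrite !(lca_child _ _ c_ds) // eq_kl.
Qed.

Lemma tree_adj_siblings (V : eqType) d (t : tree V) w k l :
  uniq (leaves t) -> siblings_at t d w k l ->
  [/\ k != l, tree_adj t k l = is_join w &
      {in [predC [:: k; l]], tree_adj t k =1 tree_adj t l}].
Proof.
move=> Ut kl_sib; have /eqP neq_kl := kl_sib.1.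
have [join_w eq_kl] := lca_siblings Ut kl_sib.
split=> // [|i i_kl]; first by rewrite /tree_adj neq_kl join_w.
move: (i_kl); rewrite /tree_adj eq_kl // !inE negb_or.
by rewrite ![i == _]eq_sym => /andP[-> ->].
Qed.

(** * Congruence and the elimination steps *)

Definition congruent (R : comUnitRingType) n (A B : 'M[R]_n) : Prop :=
  exists2 P : 'M[R]_n, P \in unitmx & B = P *m A *m P^T.

Lemma congruent_refl (R : comUnitRingType) n (A : 'M[R]_n) : congruent A A.
Proof. by exists 1%:M; rewrite ?unitmx1 // mul1mx trmx1 mulmx1. Qed.

Lemma congruent_trans (R : comUnitRingType) n (A B C : 'M[R]_n) :
  congruent A B -> congruent B C -> congruent A C.
Proof.
move=> [P Pu ->] [Q Qu ->]; exists (Q *m P); first by rewrite unitmx_mul Qu.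
by rewrite trmx_mul !mulmxA.
Qed.

(** Elementary operation: add u i times row and column k to row and column i, for
    all i at once.  The matrix I + U e_k is invertible because e_k U = u k = 0
    makes U e_k square to zero. *)
Lemma congruent_pivot (R : comUnitRingType) n (A : 'M[R]_n) (k : 'I_n)
    (u : 'I_n -> R) :
  u k = 0 ->
  congruent A (\matrix_(i, j) (A i j + u i * A k j + u j * A i k
                               + u i * u j * A k k)).
Proof.
move=> uk0; pose U : 'cV[R]_n := \col_i u i; pose e : 'rV[R]_n := delta_mx 0 k.
have eU0 : e *m U = 0.
  by rewrite -rowE; apply/matrixP=> i j; rewrite !mxE uk0.
exists (1%:M + U *m e).
  suff: (1%:M + U *m e) *m (1%:M - U *m e) = 1%:M by case/mulmx1_unit.
  rewrite mulmxBr mulmx1 mulmxDl mul1mx -mulmxA [e *m _]mulmxA eU0 mul0mx.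
  by rewrite mulmx0 addr0 addrK.
rewrite [(_ + _)^T]linearD /= trmx1 trmx_mul trmx_delta.
rewrite mulmxDl mul1mx -mulmxA -rowE mulmxDr mulmx1 mulmxDl.
rewrite [A *m _]mulmxA -colE -mulmxA [row k A *m _]mulmxA -colE.
by apply/matrixP=> i j; rewrite !mxE !big_ord1 !mxE !big_ord1 !mxE; ring.
Qed.

(** The state of the algorithm when the vertices of S remain in the cotree: the
    other vertices have been split off and only contribute their diagonal value. *)
Definition partial_mx (R : nzRingType) n (A : 'M[R]_n) (S : {set 'I_n})
    (d : {ffun 'I_n -> R}) : 'M[R]_n :=
  \matrix_(i, j) if i == j then d i else
                 if (i \in S) && (j \in S) then A i j else 0.

(** Twins have equal rows outside the columns k and l, so their difference vanishes
    there.  The three entries that survive are the values of the quadratic form on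
    the plane spanned by e_k - e_l and e_l. *)
Lemma twin_difference (R : comUnitRingType) n (A : 'M[R]_n) (S : {set 'I_n})
    (d : {ffun 'I_n -> R}) (k l : 'I_n) :
  A^T = A -> k \in S -> l \in S -> k != l ->
  {in [predD S & [:: k; l]], A k =1 A l} ->
  exists B : 'M[R]_n,
    [/\ congruent (partial_mx A S d) B,
        B k k = d k + d l - 2 * A k l,
        B k l = A k l - d l /\ B l k = A k l - d l,
        {in [predC [:: k; l]], forall i, B k i = 0 /\ B i k = 0} &
        {in predC1 k &, forall i j, B i j = partial_mx A S d i j}].
Proof.
move=> symA kS lS neq_kl twins.
have sym i j : A i j = A j i by rewrite -{1}symA mxE.
pose u i : R := if i == k then -1 else 0.
have ul : u l = 0 by rewrite /u eq_sym (negPf neq_kl).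
eexists; split; first exact: (congruent_pivot _ ul).
- rewrite !mxE /u !eqxx (negPf neq_kl) eq_sym (negPf neq_kl) kS lS /= (sym l).
  ring.
- rewrite !mxE /u !eqxx (negPf neq_kl) eq_sym (negPf neq_kl) kS lS /= (sym l).
  by split; ring.
- move=> i; rewrite !inE negb_or => /andP[ik il].
  rewrite !mxE /u !eqxx (negPf ik) eq_sym (negPf ik).
  rewrite !(eq_sym l) (negPf il) kS lS andbT /=.
  case: ifP => iS /=; last by split; ring.
  rewrite !(sym i) -twins ?inE ?negb_or ?ik ?il //.
  by split; ring.
- move=> i j; rewrite !inE => /negPf ik /negPf jk.
  by rewrite !mxE /u ik jk; ring.
Qed.

(** Write s for the new pivot at k and t for the multiple of row k that clears the
    entry (k, l).  Asking only for t * s = d l - A k l covers a nonzero pivot, where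
    t is the quotient, and also a row k which is already zero, where t = 0. *)
Lemma twins_split (F : fieldType) n (A : 'M[F]_n) (S : {set 'I_n})
    (d : {ffun 'I_n -> F}) (k l : 'I_n) (s t : F) :
  A^T = A -> k \in S -> l \in S -> k != l ->
  {in [predD S & [:: k; l]], A k =1 A l} ->
  s = d k + d l - 2 * A k l -> t * s = d l - A k l ->
  congruent (partial_mx A S d)
    (partial_mx A (S :\: [set k]) (update d k l s (d l - t * (d l - A k l)))).
Proof.
move=> symA kS lS neq_kl twins Ds Dt.
have [B [AB Bkk [Bkl Blk] Bki Bij]] := twin_difference d symA kS lS neq_kl twins.
apply: congruent_trans AB _.
pose u i : F := if i == l then t else 0.
have uk : u k = 0 by rewrite /u (negPf neq_kl).
move: (congruent_pivot B uk); congr (congruent _ _).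
apply/matrixP => i j; rewrite mxE Bkk -Ds.
have /negPf lk : l != k by rewrite eq_sym.
have [->|ik] := eqVneq i k; last have [->|jk] := eqVneq j k.
- rewrite uk !mxE ffunE !inE eqxx /=; case: eqVneq => [<-|kj].
    by rewrite uk Bkk -Ds; ring.
  have [->|jl] := eqVneq j l; first by rewrite Bkl Bkk /u eqxx -Ds mulrC Dt; ring.
  have [|-> _] := Bki j; first by rewrite !inE negb_or jl eq_sym kj.
  by rewrite /u (negPf jl); ring.
- rewrite uk !mxE !inE (negPf ik) eqxx andbF /=.
  have [->|il] := eqVneq i l.
    by rewrite Blk Bkk /u eqxx -Ds Dt; ring.
  have [|_ ->] := Bki i; first by rewrite !inE negb_or il ik.
  by rewrite /u (negPf il); ring.
rewrite Bij // !mxE !inE ik jk /= ffunE (negPf ik).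
have [->|il] := eqVneq i l; have [->|jl] := eqVneq j l => //.
- rewrite ?eqxx Bkl Blk /u eqxx -mulrA Dt; ring.
- have [|-> _] := Bki j; first by rewrite !inE negb_or jk jl.
  by rewrite /u (negPf jl) eqxx !(mulr0, mul0r, addr0).
- have [|_ ->] := Bki i; first by rewrite !inE negb_or ik il.
  by rewrite /u (negPf il) eqxx !(mulr0, mul0r, addr0).
by rewrite /u (negPf jl) (negPf il) !(mulr0, mul0r, addr0).
Qed.

(** When s = 0 but b = A k l - d l is nonzero, the form on e_k - e_l and e_l is
    hyperbolic, with matrix [0, b; b, d l].  Adding to e_l a multiple of e_k - e_l
    gives it any prescribed value c, and completing the square then makes the form
    diagonal with entries - b^2 / c and c.  The algorithm uses c = 1 at a join and
    c = d l at a union. *)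
Lemma twins_hyperbolic (F : fieldType) n (A : 'M[F]_n) (S : {set 'I_n})
    (d : {ffun 'I_n -> F}) (k l : 'I_n) (c : F) :
  A^T = A -> k \in S -> l \in S -> k != l ->
  {in [predD S & [:: k; l]], A k =1 A l} ->
  d k + d l = 2 * A k l -> 2 != 0 :> F -> A k l != d l -> c != 0 ->
  congruent (partial_mx A S d)
    (partial_mx A (S :\: [set k; l])
       (update d k l (- ((A k l - d l) ^+ 2 / c)) c)).
Proof.
move=> symA kS lS neq_kl twins sum0 two_neq0 neq_Akl c_neq0.
have [B [AB Bkk [Bkl Blk] Bki Bij]] := twin_difference d symA kS lS neq_kl twins.
rewrite sum0 subrr in Bkk; set b := A k l - d l in Bkl Blk *.
have b_neq0 : b != 0 by rewrite subr_eq0.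
have /negPf lk : l != k by rewrite eq_sym.
apply: congruent_trans AB _.
(* The pivot b = B k l clears all entries B i l outside the plane; the coefficient
   at l changes B l l = d l into d l + 2 u(l) b = c. *)
pose u i : F :=
  if i == k then 0 else if i == l then (c - d l) / (2 * b) else - (B i l / b).
have uk : u k = 0 by rewrite /u eqxx.
have ul : u l = (c - d l) / (2 * b) by rewrite /u lk eqxx.
have ui i : i != k -> i != l -> u i = - (B i l / b).
  by move=> /negPf ik /negPf il; rewrite /u ik il.
apply: congruent_trans (congruent_pivot B uk) _.
set M := \matrix_(i, j) _.
have ME i j : M i j = B i j + u i * B k j + u j * B i k by rewrite mxE Bkk mulr0 addr0.
have Bll : B l l = d l by rewrite Bij ?inE ?lk // mxE eqxx.
have symB i : i != k -> i != l -> B l i = B i l.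
  move=> ik il; rewrite !Bij ?inE ?lk // !mxE (negPf il) eq_sym (negPf il).
  by rewrite andbC -{1}symA mxE.
have Mkk : M k k = 0 by rewrite ME uk Bkk; ring.
have Mkl : M k l = b by rewrite ME uk Bkk Bkl; ring.
have Mlk : M l k = b by rewrite ME uk Bkk Blk; ring.
have Mll : M l l = c.
  by rewrite ME ul Bkl Blk Bll; field; rewrite two_neq0 b_neq0.
have Mki i : i != k -> i != l -> M k i = 0 /\ M i k = 0.
  move=> ik il; have [|Bki0 Bik0] := Bki i; first by rewrite !inE negb_or ik.
  by rewrite !ME uk Bkk Bki0 Bik0 !(mulr0, mul0r, addr0).
have Mli i : i != k -> i != l -> M l i = 0 /\ M i l = 0.
  move=> ik il; have [|Bki0 Bik0] := Bki i; first by rewrite !inE negb_or ik.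
  rewrite !ME (ui i ik il) symB // Bkl Blk Bki0 Bik0 !(mulr0, addr0).
  by rewrite mulNr mulfVK // subrr.
have Mij i j : i != k -> i != l -> j != k -> j != l -> M i j = partial_mx A S d i j.
  move=> ik il jk jl.
  have [|Bkj0 _] := Bki j; first by rewrite !inE negb_or jk.
  have [|_ Bik0] := Bki i; first by rewrite !inE negb_or ik.
  by rewrite ME Bkj0 Bik0 !(mulr0, addr0) Bij ?inE.
clearbody M.
(* Complete the square: clear the entry (k, l) with the pivot c at l. *)
pose v i : F := if i == k then - (b / c) else 0.
have vl : v l = 0 by rewrite /v lk.
have vi i : i != k -> v i = 0 by move=> /negPf ik; rewrite /v ik.
have vk : v k = - (b / c) by rewrite /v eqxx.
move: (congruent_pivot M vl); congr (congruent _ _).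
apply/matrixP => i j; rewrite mxE Mll.
have [->|ik] := eqVneq i k; have [->|jk] := eqVneq j k.
- by rewrite !mxE eqxx ffunE eqxx vk Mkk Mkl Mlk; field.
- rewrite mxE !inE eqxx /= eq_sym (negPf jk) vk (vi j) //.
  have [->|jl] := eqVneq j l; first by rewrite Mkl Mll; field.
  by rewrite (Mki j jk jl).1 (Mli j jk jl).1 !(mulr0, mul0r, addr0).
- rewrite mxE !inE eqxx andbF (negPf ik) vk (vi i) //.
  have [->|il] := eqVneq i l; first by rewrite Mlk Mll; field.
  by rewrite (Mki i ik il).2 (Mli i ik il).2 !(mulr0, mul0r, addr0).
rewrite (vi i) // (vi j) // !mul0r !addr0.
rewrite mxE !inE (negPf ik) (negPf jk) ffunE (negPf ik) /=.
have [->|il] := eqVneq i l; have [->|jl] := eqVneq j l => //=.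
- by rewrite (Mli j jk jl).1.
- by rewrite (Mli i ik il).2 (negPf il) andbF.
by rewrite Mij // mxE.
Qed.

(** The six cases of the algorithm are instances of the two reductions of twins. *)
Lemma congruent_process (F : fieldType) n (A : 'M[F]_n) (S : {set 'I_n})
    (d : {ffun 'I_n -> F}) (k l : 'I_n) w dk dl both :
  A^T = A -> k \in S -> l \in S -> k != l ->
  {in [predD S & [:: k; l]], A k =1 A l} ->
  A k l = (is_join w)%:R -> 2 != 0 :> F ->
  process w (d k) (d l) = (dk, dl, both) ->
  congruent (partial_mx A S d)
    (partial_mx A (S :\: (if both then [set k; l] else [set k]))
                (update d k l dk dl)).
Proof.
move=> symA kS lS neq_kl twins Akl two_neq0.
have split s t := @twins_split F n A S d k l s t symA kS lS neq_kl twins.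
have hyp c := @twins_hyperbolic F n A S d k l c symA kS lS neq_kl twins.
rewrite Akl in split hyp; case: w {Akl} split hyp => /= split hyp.
- case: eqVneq => [sum0|s_neq0] /=; last first.
    case=> <- <- <-; have ->: d k * d l / (d k + d l)
      = d l - d l / (d k + d l) * (d l - 0) by field.
    by apply: split; [rewrite mulr0 subr0 | rewrite divfK ?subr0].
  have [dl0|dl_neq0] := eqVneq (d l) 0; case=> <- <- <-.
    have := split 0 0; rewrite dl0 !mul0r !subr0; apply=> //.
    by rewrite -dl0 sum0 mulr0 subr0.
  have := hyp (d l); rewrite sub0r sqrrN expr2 mulfK //; apply=> //.
  - by rewrite sum0 mulr0.
  - by rewrite eq_sym.
- case: eqVneq => [sum2|s_neq0] /=; last first.
    have s_neq0' : d k + d l - 2 != 0 by rewrite subr_eq0.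
    case=> <- <- <-; have ->: (d k * d l - 1) / (d k + d l - 2)
      = d l - (d l - 1) / (d k + d l - 2) * (d l - 1) by field.
    by apply: split; [rewrite mulr1 | rewrite divfK].
  have [dl1|dl_neq1] := eqVneq (d l) 1; case=> <- <- <-.
    have := split 0 0; rewrite dl1 !mul0r subr0 mulr1 subrr; apply=> //.
    by move: sum2; rewrite dl1 => ->; rewrite subrr.
  have := hyp 1; rewrite divr1; apply=> //; rewrite ?oner_neq0 //.
  - by rewrite sum2 mulr1.
  - by rewrite eq_sym.
Qed.

(** The cotrees met along a run describe the same relation e on smaller and smaller
    sets S, so the matrix A never changes: only S and d do. *)
Lemma diag_loop_congruent (F : fieldType) n (e : rel 'I_n) (A : 'M[F]_n)
    (ot : option (tree 'I_n)) (d D : {ffun 'I_n -> F}) (S : {set 'I_n}) :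
  A^T = A -> (forall i j, A i j = (e i j)%:R) -> 2 != 0 :> F ->
  is_cotree_opt S e ot -> diag_loop ot d D ->
  congruent (partial_mx A S d) (diag_mx (\row_i D i)).
Proof.
move=> symA Ae two_neq0 + dD; elim: dD S => {ot d D} [d|t d|t d ot d' D].
- move=> S /= ->; have -> : partial_mx A set0 d = diag_mx (\row_i d i).
    by apply/matrixP=> i j; rewrite !mxE inE; case: eqP => // _.
  exact: congruent_refl.
- move=> le1 S /= [_ Ut tS _].
  have -> : partial_mx A S d = diag_mx (\row_i d i).
    apply/matrixP=> i j; rewrite !mxE; case: eqVneq => // neq_ij.
    case: ifP => // /andP[]; rewrite -!tS.
    case: (leaves t) le1 => [|x [|//]] // _.
    by rewrite !inE => /eqP xi /eqP xj; rewrite xi xj eqxx in neq_ij.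
  exact: congruent_refl.
move=> _ [w k l dk dl both [h kl_sib _] proc cot] _ IH S /= [shape Ut tS et].
have [kS lS] := siblings_leaves kl_sib; rewrite !tS in kS lS.
have [neq_kl adj_kl twins] := tree_adj_siblings Ut kl_sib.
have DS : [set v in leaves t] = S by apply/setP=> i; rewrite inE tS.
rewrite DS in cot; move: cot proc; set S' := S :\: _ => cot proc.
have sub : {subset S' <= S} by apply/subsetP/subsetDl.
apply: (congruent_trans (congruent_process symA kS lS neq_kl _ _ two_neq0 proc)).
- move=> i /andP[i_kl iS]; move: (i_kl); rewrite !inE negb_or => /andP[ik il].
  by rewrite !Ae !et // 1?eq_sym // twins.
- by rewrite Ae et // adj_kl.
apply: IH; case: ot cot => //= t' [shape' Ut' tS' et']; split=> // i j iS jS ij.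
by rewrite -et' // et ?sub.
Qed.

(** * Sylvester's law of inertia *)

Local Open Scope sesquilinear_scope.

Lemma diag_formE (C : numClosedFieldType) n (x : 'rV[C]_n) (v : 'rV[C]_n) :
  (v *m diag_mx x *m v^t*) 0 0 = \sum_i x 0 i * `|v 0 i| ^+ 2.
Proof.
rewrite mxE; apply: eq_bigr => i _; rewrite mul_mx_diag !mxE normCK.
by rewrite mulrA (mulrC (v 0 i)).
Qed.

(** If x had more positive entries than y, then by counting dimensions some nonzero
    v supported on the positive entries of x would be such that v P vanishes at the
    positive entries of y.  The form would be positive at v by its expression
    through x, and nonpositive by its expression through y. *)
Lemma inertia_le (C : numClosedFieldType) n (P : 'M[C]_n) (x y : 'rV[C]_n) :
  y \is a realmx -> diag_mx x = P *m diag_mx y *m P^t* ->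
  (#|[set i | (0 < x 0 i)%R]| <= #|[set i | (0 < y 0 i)%R]|)%N.
Proof.
move=> yreal xPy; set X := [set i | _]; set Y := [set i | _].
rewrite leqNgt; apply/negP => ltYX.
pose M : 'M[C]_(#|X|, #|Y|) := \matrix_(i, j) P (enum_val i) (enum_val j).
have [c cM0 c_neq0] : exists2 c : 'rV[C]_#|X|, c *m M = 0 & c != 0.
  have kerM : kermx M != 0.
    rewrite -mxrank_eq0 mxrank_ker -lt0n subn_gt0.
    exact: leq_ltn_trans (rank_leq_col M) ltYX.
  by have /rowV0Pn[c /sub_kermxP] := kerM; exists c.
pose v : 'rV[C]_n := c *m rowsub enum_val 1%:M.
have vX i : i \notin X -> v 0 i = 0.
  move=> iX; rewrite mxE big1 // => a _; rewrite !mxE.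
  case: eqP => [ai|_]; last by rewrite mulr0.
  by rewrite -ai enum_valP in iX.
have vPY j : 0 < y 0 j -> (v *m P) 0 j = 0.
  move=> yj; have jY : j \in Y by rewrite inE.
  have /matrixP/(_ 0 (enum_rank_in jY j)) := cM0.
  rewrite -mulmxA mul_rowsub_mx mul1mx mxE [X in _ = X -> _]mxE => <-.
  rewrite mxE; apply: eq_bigr => a _.
  by rewrite !mxE enum_rankK_in.
have v_neq0 : exists2 i, i \in X & v 0 i != 0.
  have /rV0Pn[a ca] := c_neq0; exists (enum_val a); first exact: enum_valP.
  rewrite mxE (bigD1 a) //= big1 => [|b ba].
    by rewrite !mxE eqxx mulr1 addr0.
  by rewrite !mxE (inj_eq enum_val_inj) (negPf ba) mulr0.
clearbody v; have := diag_formE x v; rewrite xPy.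
have -> : v *m (P *m diag_mx y *m P^t*) *m v^t*
          = (v *m P) *m diag_mx y *m (v *m P)^t*.
  by rewrite trmx_mul map_mxM !mulmxA.
rewrite diag_formE => eq_sums.
have le0 : \sum_i y 0 i * `|(v *m P) 0 i| ^+ 2 <= 0.
  apply: sumr_le0 => i _; have /mxOverP/(_ 0 i) yi := yreal.
  have [yi0|] := real_ltP (real0 _) yi.
    by rewrite vPY // normr0 expr0n mulr0.
  by move=> yi0; rewrite mulr_le0_ge0 // exprn_ge0.
move: le0; rewrite eq_sums; apply/negP; rewrite lt_geF //.
have [i iX vi] := v_neq0; rewrite (bigD1 i) //=.
apply: ltr_pwDl; first by rewrite mulr_gt0 ?exprn_gt0 ?normr_gt0 //; rewrite inE in iX.
apply: sumr_ge0 => j _; have [|jX] := boolP (j \in X).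
  by rewrite inE => /ltW xj; rewrite mulr_ge0 // exprn_ge0.
by rewrite vX // normr0 expr0n mulr0.
Qed.

Lemma inertia_eq (C : numClosedFieldType) n (P : 'M[C]_n) (x y : 'rV[C]_n) :
  P \in unitmx -> x \is a realmx -> y \is a realmx ->
  diag_mx x = P *m diag_mx y *m P^t* ->
  #|[set i | (0 < x 0 i)%R]| = #|[set i | (0 < y 0 i)%R]|.
Proof.
move=> Pu xr yr xPy; apply/eqP; rewrite eqn_leq (inertia_le yr xPy) /=.
apply: (inertia_le xr (P := invmx P)); rewrite xPy !mulmxA mulVmx // mul1mx.
rewrite -mulmxA -map_mxM -trmx_mul mulVmx // trmx1 map_mx1 mulmx1.
by [].
Qed.

(** * The spectrum of a real symmetric matrix *)

(** The distinct roots, each repeated as often as its multiplicity, are the same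
    multiset as the roots of the linear factors, since multiplicities add up. *)
Lemma eigenvalues_perm (R : rcfType) n (A : 'M[R]_n) (s : seq R) :
  char_poly A = \prod_(x <- s) ('X - x%:P) -> perm_eq (eigenvalues A) s.
Proof.
move=> DA; have A_neq0 : char_poly A != 0 by rewrite monic_neq0 ?char_poly_monic.
have mult x : eigen_mult A x = count_mem x s.
  by rewrite /eigen_mult DA mu_prod_XsubC.
apply/allP => x _ /=; apply/eqP; rewrite -mult /eigenvalues.
rewrite count_flatten -map_comp.
transitivity (\sum_(y <- rootsR (char_poly A)) (y == x) * eigen_mult A y)%N.
  by rewrite sumnE big_map; apply: eq_bigr => y _; rewrite /= count_nseq.
have [xr|xNr] := boolP (x \in rootsR (char_poly A)).
  rewrite (bigD1_seq x) ?uniq_roots //= eqxx mul1n big1 ?addn0 // => y.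
  by move=> /negPf->.
rewrite big1_seq => [|y /andP[_ yr]].
  rewrite /eigen_mult mupNroot //; apply: contra xNr => rx.
  by rewrite -(roots_on_rootsR A_neq0) rx inE.
by case: eqP => // yx; rewrite -yx yr in xNr.
Qed.

Lemma char_poly_similar (R : comUnitRingType) n (P A : 'M[R]_n) :
  P \in unitmx -> char_poly (invmx P *m A *m P) = char_poly A.
Proof.
move=> Pu; pose f := map_mx (@polyC R).
have PV : f n n (invmx P) *m f n n P = 1%:M by rewrite -map_mxM mulVmx // map_mx1.
have -> : char_poly (invmx P *m A *m P)
        = \det (f n n (invmx P) *m char_poly_mx A *m f n n P).
  congr (\det _); rewrite /char_poly_mx mulmxBr mulmxBl -!map_mxM; congr (_ - _).
  by rewrite scalar_mxC -mulmxA PV mulmx1.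
by rewrite !det_mulmx mulrAC -det_mulmx PV det1 mul1r.
Qed.

Lemma char_poly_diag (R : comNzRingType) n (x : 'rV[R]_n) :
  char_poly (diag_mx x) = \prod_i ('X - (x 0 i)%:P).
Proof.
rewrite char_poly_trig ?diag_mx_is_trig //.
by apply: eq_bigr => i _; rewrite mxE eqxx.
Qed.

Local Notation toC R := (real_complex R).

Lemma real_complex_real (R : rcfType) m n (A : 'M[R]_(m, n)) :
  map_mx (toC R) A \is a realmx.
Proof.
apply/mxOverP => i j; rewrite mxE; apply/complex_realP; by exists (A i j).
Qed.

(** The spectral theorem for hermitian matrices gives real eigenvalues; the unitary
    matrix may be complex, which is harmless for counting signs. *)
Lemma real_symmetric_spectral (R : rcfType) n (A : 'M[R]_n) : A^T = A ->
  exists r : 'rV[R]_n, exists2 U : 'M[R[i]]_n, U \is unitarymx &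
    map_mx (toC R) A = U^t* *m diag_mx (map_mx (toC R) r) *m U.
Proof.
move=> symA; set B := map_mx _ A.
have symB : B \is symmetricmx.
  by apply/is_hermitianmxP; rewrite expr0 scale1r map_mx_id // map_trmx symA.
have hermB := realsym_hermsym symB (real_complex_real A).
have rB := hermitian_spectral_diag_real hermB.
exists (map_mx (@complex.Re R) (spectral_diag B)), (spectralmx B).
  exact: spectral_unitarymx.
have /orthomx_spectralP DB := hermitian_normalmx hermB.
rewrite -invmx_unitary ?spectral_unitarymx // [LHS]DB.
congr (_ *m diag_mx _ *m _); apply/matrixP=> i j; rewrite !mxE RRe_real //.
exact/mxOverP.
Qed.

Lemma unitary_conj_shift (C : numClosedFieldType) n (U A : 'M[C]_n)
    (x : 'rV[C]_n) (a : C) :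
  U \is unitarymx -> A = U^t* *m diag_mx x *m U ->
  A - a%:M = U^t* *m diag_mx (x - const_mx a) *m U.
Proof.
move=> Uu ->; rewrite linearB /= diag_const_mx mulmxBr mulmxBl; congr (_ - _).
by rewrite mul_mx_scalar -scalemxAl -invmx_unitary // mulVmx ?unitarymx_unit // scalemx1.
Qed.

Lemma card_trichotomy (R : realDomainType) (I : finType) (f : I -> R) (b : R) :
  (#|[set i | (b < f i)%R]| + #|[set i | (f i < b)%R]| + #|[set i | f i == b]|)%N
  = #|I|.
Proof.
have card_sum (p : pred I) : #|[set i | p i]| = (\sum_i p i)%N.
  by rewrite -sum1dep_card big_mkcond; apply: eq_bigr => i _; case: (p i).
rewrite -[RHS]sum1_card !card_sum -!big_split /=.
by apply: eq_bigr => i _; case: ltgtP.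
Qed.

(** A unitary matrix brings A - a I to the diagonal r - a, where r lists the
    eigenvalues of A, and a real invertible one brings it to the diagonal x, so these
    two diagonal matrices are congruent over the complex numbers.  Negative entries
    are positive entries of the opposite matrices, and the zeros are what remains. *)
Lemma congruent_inertia (R : rcfType) n (A : 'M[R]_n) (a : R) (x : 'rV[R]_n) :
  A^T = A -> congruent (A - a%:M) (diag_mx x) ->
  [/\ count (fun b => a < b) (eigenvalues A) = #|[set i | (0 < x 0 i)%R]|,
      count (fun b => b < a) (eigenvalues A) = #|[set i | (x 0 i < 0)%R]|
    & eigen_mult A a = #|[set i | x 0 i == 0]|].
Proof.
move=> symA [P Pu xP]; have [r [U Uu AU]] := real_symmetric_spectral symA.
pose Q := map_mx (toC R) P *m U^t*.
have Qu : Q \in unitmx.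
  by rewrite unitmx_mul map_unitmx Pu -invmx_unitary // unitmx_inv unitarymx_unit.
have xQ : diag_mx (map_mx (toC R) x)
          = Q *m diag_mx (map_mx (toC R) (r - const_mx a)) *m Q^t*.
  rewrite -map_diag_mx xP !map_mxM map_mxB map_scalar_mx.
  rewrite (unitary_conj_shift _ Uu AU) trmx_mul map_mxM trmxCK.
  rewrite map_mxB map_const_mx !mulmxA; congr (_ *m _).
  by rewrite map_trmx realmxC ?real_complex_real.
have realC := @real_complex_real R.
have pos : #|[set i | (0 < x 0 i)%R]| = #|[set i | (a < r 0 i)%R]|.
  have := inertia_eq Qu (realC _ _ _) (realC _ _ _) xQ.
  by under eq_finset do rewrite mxE ltcR;
     under [X in _ = #|pred_of_set X|]eq_finset do rewrite !mxE ltcR subr_gt0.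
have neg : #|[set i | (x 0 i < 0)%R]| = #|[set i | (r 0 i < a)%R]|.
  have xQN : diag_mx (map_mx (toC R) (- x))
          = Q *m diag_mx (map_mx (toC R) (- (r - const_mx a))) *m Q^t*.
    have diagN (z : 'rV[R[i]]_n) : diag_mx (- z) = - diag_mx z by rewrite linearN.
    by rewrite !map_mxN !diagN xQ mulmxN mulNmx.
  have := inertia_eq Qu (realC _ _ _) (realC _ _ _) xQN.
  by under eq_finset do rewrite !mxE ltcR oppr_gt0;
     under [X in _ = #|pred_of_set X|]eq_finset do
       rewrite !mxE ltcR oppr_gt0 subr_lt0.
have cA : char_poly A = \prod_(b <- [seq r 0 i | i : 'I_n]) ('X - b%:P).
  apply: (map_poly_inj (toC R)); rewrite map_char_poly AU -invmx_unitary //.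
  rewrite char_poly_similar ?unitarymx_unit // char_poly_diag.
  rewrite rmorph_prod big_map big_enum /=; apply: eq_bigr => i _.
  by rewrite mxE rmorphB /= map_polyX map_polyC.
have cnt (p : pred R) : count p [seq r 0 i | i : 'I_n] = #|[set i | p (r 0 i)]|.
  by rewrite -sum1_count big_map big_enum_cond -sum1dep_card.
have /permP cntA := eigenvalues_perm cA.
split; first by rewrite cntA cnt pos.
  by rewrite cntA cnt neg.
rewrite /eigen_mult cA mu_prod_XsubC cnt.
have := card_trichotomy (x 0) 0; rewrite -(card_trichotomy (r 0) a) -pos -neg.
by move=> /addnI.
Qed.

(** * Eigenvalue location *)

Lemma adjmx_sym (R : nzRingType) n (G : sgraph 'I_n) : (adjmx R G)^T = adjmx R G.
Proof. by apply/matrixP=> i j; rewrite !mxE adj_sym. Qed.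

Lemma partial_mx_init (R : nzRingType) n (G : sgraph 'I_n) (a : R) :
  partial_mx (adjmx R G) [set: 'I_n] [ffun=> - a] = adjmx R G - a%:M.
Proof.
apply/matrixP=> i j; rewrite !mxE !inE ffunE /=.
by case: eqVneq => [->|_]; rewrite ?adj_irr ?sub0r ?mulr1n ?mulr0n ?subr0.
Qed.

Theorem theorem3 (R : realType) (n : nat) (G : sgraph 'I_n) (T : tree 'I_n)
    (a : R) (D : {ffun 'I_n -> R}) (kpos kzero kneg : nat)
    (G_cograph : cograph G)
    (T_cotree : is_cotree [set: 'I_n] G T)
    (D_output : Diagonalize T (- a) D)
    (D_pos : #|[set i | 0 < D i]| = kpos)
    (D_zero : #|[set i | D i == 0]| = kzero)
    (D_neg : #|[set i | D i < 0]| = kneg) :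
  [/\ count (fun x => a < x) (eigenvalues (adjmx R G)) = kpos,
      count (fun x => x < a) (eigenvalues (adjmx R G)) = kneg
    & eigen_mult (adjmx R G) a = kzero].
Proof.
have two_neq0 : 2 != 0 :> R by rewrite pnatr_eq0.
have AG i j : adjmx R G i j = (G i j)%:R by rewrite mxE.
have := diag_loop_congruent (ot := Some T) (adjmx_sym R G) AG two_neq0 T_cotree
  D_output.
rewrite partial_mx_init => AD.
have [pos neg zero] := congruent_inertia (adjmx_sym R G) AD.
rewrite pos neg zero -D_pos -D_neg -D_zero.
by split; apply: eq_card => i; rewrite !inE mxE.
Qed.
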